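(* For every sequent $\alpha\vdash\beta$ in the language of $\mathbf{MCDBL}$: 1. $\alpha\vdash\beta$ is provable in $\mathbf{MCDBL}$ if and only if $\alpha\vdash\beta$ is valid in the class of all contextual dBaos. 2. $\alpha\vdash\beta$ is provable in $\mathbf{MCDBL4}$ if and only if $\alpha\vdash\beta$ is valid in the class of all topological contextual dBas.
   Context: **Double Boolean algebras.** A double Boolean algebra (dBa) is an algebra $\mathbf{D}=(D,\sqcup,\sqcap,\neg,\lrcorner,\top,\bot)$ such that, writing $x\vee y:=\neg(\neg x\sqcap\neg y)$ and $x\wedge y:=\lrcorner(\lrcorner x\sqcup\lrcorner y)$, for all $x,y,z\in D$: (1a) $(x\sqcap x)\sqcap y=x\sqcap y$; (1b) $(x\sqcup x)\sqcup y=x\sqcup y$; (2a) $x\sqcap y=y\sqcap x$; (2b) $x\sqcup y=y\sqcup x$; (3a) $x\sqcap(y\sqcap z)=(x\sqcap y)\sqcap z$; (3b) $x\sqcup(y\sqcup z)=(x\sqcup y)\sqcup z$; (4a) $\neg(x\sqcap x)=\neg x$; (4b) $\lrcorner(x\sqcup x)=\lrcorner x$; (5a) $x\sqcap(x\sqcup y)=x\sqcap x$; (5b) $x\sqcup(x\sqcap y)=x\sqcup x$; (6a) $x\sqcap(y\vee z)=(x\sqcap y)\vee(x\sqcap z)$; (6b) $x\sqcup(y\wedge z)=(x\sqcup y)\wedge(x\sqcup z)$; (7a) $x\sqcap(x\vee y)=x\sqcap x$; (7b) $x\sqcup(x\wedge y)=x\sqcup x$; (8a) $\neg\neg(x\sqcap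 y)=x\sqcap y$; (8b) $\lrcorner\lrcorner(x\sqcup y)=x\sqcup y$; (9a) $x\sqcap\neg x=\bot$; (9b) $x\sqcup\lrcorner x=\top$; (10a) $\neg\bot=\top\sqcap\top$; (10b) $\lrcorner\top=\bot\sqcup\bot$; (11a) $\neg\top=\bot$; (11b) $\lrcorner\bot=\top$; (12) $(x\sqcap x)\sqcup(x\sqcap x)=(x\sqcup x)\sqcap(x\sqcup x)$. The quasi-order is: $x\sqsubseteq y$ iff $x\sqcap y=x\sqcap x$ and $x\sqcup y=y\sqcup y$. $\mathbf{D}$ is contextual if $\sqsubseteq$ is a partial order. **dBao and topological dBa.** A dBa with operators (dBao) is $\mathfrak{O}=(D,\sqcup,\sqcap,\neg,\lrcorner,\top_D,\bot_D,\mathbf{I},\mathbf{C})$ where the reduct without $\mathbf{I},\mathbf{C}$ is a dBa and $\mathbf{I},\mathbf{C}:D\to D$ are monotone with respect to $\sqsubseteq$ and satisfy, for all $x,y$: $\mathbf{I}(x\sqcap y)=\mathbf{I}(x)\sqcap\mathbf{I}(y)$, $\mathbf{C}(x\sqcup y)=\mathbf{C}(x)\sqcup\mathbf{C}(y)$, $\mathbf{I}(\neg\bot)=\neg\bot$, $\mathbf{C}(\lrcorner\top)=\lrcorner\top$, $\mathbf{I}(x\sqcap x)=\mathbf{I}(x)$, $\mathbf{C}(x\sqcup x)=\mathbf{C}(x)$. A topological dBa is a dBao that also satisfies, for all $x$: $\mathbf{I}(x)\sqsubseteq x$, $x\sqsubseteq\mathbf{C}(x)$, $\mathbf{I}\mathbf{I}(x)=\mathbf{I}(x)$,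 $\mathbf{C}\mathbf{C}(x)=\mathbf{C}(x)$. A contextual dBao (topological contextual dBa) is one whose underlying dBa is contextual. **The logics.** Formulae of $\mathbf{MCDBL}$ (set $\mathfrak{F}_1$) are generated from a countably infinite set $\mathbf{PV}$ of propositional variables and constants $\top,\bot$ by binary connectives $\sqcup,\sqcap$ and unary connectives $\neg,\lrcorner,\square,\blacksquare$. Abbreviations: $\alpha\vee\beta:=\neg(\neg\alpha\sqcap\neg\beta)$, $\alpha\wedge\beta:=\lrcorner(\lrcorner\alpha\sqcup\lrcorner\beta)$. A sequent is a pair of formulae, written $\alpha\vdash\beta$; $\alpha\dashv\vdash\beta$ stands for both $\alpha\vdash\beta$ and $\beta\vdash\alpha$. Axiom schemata of $\mathbf{MCDBL}$ ($\alpha,\beta,\gamma$ ranging over $\mathfrak{F}_1$): (1) $\alpha\vdash\alpha$; (2a) $\alpha\sqcap\beta\vdash\alpha$; (2b) $\alpha\vdash\alpha\sqcup\beta$; (3a) $\alpha\sqcap\beta\vdash\beta$; (3b) $\beta\vdash\alpha\sqcup\beta$; (4a) $\alpha\sqcap\beta\vdash(\alpha\sqcap\beta)\sqcap(\alpha\sqcap\beta)$; (4b) $(\alpha\sqcup\beta)\sqcup(\alpha\sqcup\beta)\vdash\alpha\sqcup\beta$; (5a) $\neg(\alpha\sqcap\alpha)\vdash\neg\alpha$; (5b) $\lrcorner\alpha\vdash\lrcorner(\alpha\sqcup\alpha)$; (6a) $\alpha\sqcap\neg\alpha\vdash\bot$; (6b) $\top\vdash\alpha\sqcup\lrcorner\alpha$;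 (7a) $\neg\neg(\alpha\sqcap\beta)\dashv\vdash\alpha\sqcap\beta$; (7b) $\lrcorner\lrcorner(\alpha\sqcup\beta)\dashv\vdash\alpha\sqcup\beta$; (8a) $\alpha\sqcap\alpha\vdash\alpha\sqcap(\alpha\sqcup\beta)$; (8b) $\alpha\sqcup(\alpha\sqcap\beta)\vdash\alpha\sqcup\alpha$; (9a) $\alpha\sqcap\alpha\vdash\alpha\sqcap(\alpha\vee\beta)$; (9b) $\alpha\sqcup(\alpha\wedge\beta)\vdash\alpha\sqcup\alpha$; (10a) $\alpha\sqcap(\beta\vee\gamma)\dashv\vdash(\alpha\sqcap\beta)\vee(\alpha\sqcap\gamma)$; (10b) $\alpha\sqcup(\beta\wedge\gamma)\dashv\vdash(\alpha\sqcup\beta)\wedge(\alpha\sqcup\gamma)$; (11a) $\bot\vdash\alpha$; (11b) $\alpha\vdash\top$; (12a) $\neg\top\vdash\bot$; (12b) $\top\vdash\lrcorner\bot$; (13a) $\neg\bot\dashv\vdash\top\sqcap\top$; (13b) $\lrcorner\top\dashv\vdash\bot\sqcup\bot$; (14) $(\alpha\sqcup\alpha)\sqcap(\alpha\sqcup\alpha)\dashv\vdash(\alpha\sqcap\alpha)\sqcup(\alpha\sqcap\alpha)$; (15a) $\square\alpha\sqcap\square\beta\dashv\vdash\square(\alpha\sqcap\beta)$; (15b) $\blacksquare\alpha\sqcup\blacksquare\beta\dashv\vdash\blacksquare(\alpha\sqcup\beta)$; (16a) $\square(\neg\bot)\dashv\vdash\neg\bot$; (16b) $\blacksquare(\lrcorner\top)\dashv\vdash\lrcorner\top$;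 (17a) $\square(\alpha\sqcap\alpha)\dashv\vdash\square\alpha$; (17b) $\blacksquare(\alpha\sqcup\alpha)\dashv\vdash\blacksquare\alpha$. Rules: from $\alpha\vdash\beta$ infer (R1) $\alpha\sqcap\gamma\vdash\beta\sqcap\gamma$, (R1)$'$ $\gamma\sqcap\alpha\vdash\gamma\sqcap\beta$, (R2) $\alpha\sqcup\gamma\vdash\beta\sqcup\gamma$, (R2)$'$ $\gamma\sqcup\alpha\vdash\gamma\sqcup\beta$, (R3) $\neg\beta\vdash\neg\alpha$, (R3)$'$ $\lrcorner\beta\vdash\lrcorner\alpha$, (R8) $\square\alpha\vdash\square\beta$, (R9) $\blacksquare\alpha\vdash\blacksquare\beta$; (R4) from $\alpha\vdash\beta$ and $\beta\vdash\gamma$ infer $\alpha\vdash\gamma$; (R5) from $\alpha\sqcap\beta\vdash\alpha\sqcap\alpha$, $\alpha\sqcap\alpha\vdash\alpha\sqcap\beta$, $\alpha\sqcup\beta\vdash\beta\sqcup\beta$ and $\beta\sqcup\beta\vdash\alpha\sqcup\beta$ infer $\alpha\vdash\beta$. $\mathbf{MCDBL4}$ is obtained from $\mathbf{MCDBL}$ by adding the axiom schemata (18a) $\square\alpha\vdash\alpha$; (18b) $\alpha\vdash\blacksquare\alpha$; (19a) $\square\square\alpha\dashv\vdash\square\alpha$; (19b) $\blacksquare\blacksquare\alpha\dashv\vdash\blacksquare\alpha$. A sequent is provable if it is the last member of a finite sequence of sequents, each an axiom or obtained from earlier ones by a rule. **Validity.** A valuation on a contextual dBao $\mathfrak{O}$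 is a map $v:\mathfrak{F}_1\to D$ commuting with $\sqcup,\sqcap,\neg,\lrcorner$, sending $\top,\bot$ to $\top_D,\bot_D$, and with $v(\square\alpha)=\mathbf{I}(v(\alpha))$, $v(\blacksquare\alpha)=\mathbf{C}(v(\alpha))$. $v$ satisfies $\alpha\vdash\beta$ iff $v(\alpha)\sqsubseteq v(\beta)$. $\alpha\vdash\beta$ is true in $\mathfrak{O}$ iff every valuation on $\mathfrak{O}$ satisfies it, and valid in a class iff true in every member. *)

(* Defs.v *)
From Stdlib Require Import List Relation_Definitions.
Import ListNotations.

Set Implicit Arguments.
Unset Strict Implicit.
Unset Printing Implicit Defensive.

Reserved Notation "¬ x" (at level 35, right associativity).
Reserved Notation "⌟ x" (at level 35, right associativity).
Reserved Notation "□ x" (at level 35, right associativity).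
Reserved Notation "■ x" (at level 35, right associativity).
Reserved Notation "x ⊓ y" (at level 45, no associativity).
Reserved Notation "x ⊔ y" (at level 45, no associativity).
Reserved Notation "x ⋎ y" (at level 45, no associativity).
Reserved Notation "x ⋏ y" (at level 45, no associativity).
Reserved Notation "x ⊑ y" (at level 70, no associativity).
Reserved Notation "x ⊢ y" (at level 70, no associativity).

(** * Double Boolean algebras *)

Record dBaSig := {
  carrier :> Type;
  djoin : carrier -> carrier -> carrier;
  dmeet : carrier -> carrier -> carrier;
  dneg : carrier -> carrier;
  dopp : carrier -> carrier;
  dtop : carrier;
  dbot : carrier
}.

Arguments djoin {_} x y.
Arguments dmeet {_} x y.
Arguments dneg {_} x.
Arguments dopp {_} x.
Arguments dtop {_}.
Arguments dbot {_}.

Declare Scope dba_scope.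
Delimit Scope dba_scope with D.
Bind Scope dba_scope with carrier.

Notation "x ⊔ y" := (djoin x y) : dba_scope.
Notation "x ⊓ y" := (dmeet x y) : dba_scope.
Notation "¬ x" := (dneg x) : dba_scope.
Notation "⌟ x" := (dopp x) : dba_scope.
Notation "⊤" := dtop : dba_scope.
Notation "⊥" := dbot : dba_scope.

Definition dvee (A : dBaSig) (x y : A) : A := (¬ (¬ x ⊓ ¬ y))%D.
Definition dwedge (A : dBaSig) (x y : A) : A := (⌟ (⌟ x ⊔ ⌟ y))%D.

Notation "x ⋎ y" := (dvee x y) : dba_scope.
Notation "x ⋏ y" := (dwedge x y) : dba_scope.

Definition dle (A : dBaSig) (x y : A) : Prop :=
  (x ⊓ y = x ⊓ x)%D /\ (x ⊔ y = y ⊔ y)%D.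

Notation "x ⊑ y" := (dle x y) : dba_scope.

Local Open Scope dba_scope.

Record is_dBa (A : dBaSig) : Prop := {
  dba1a : forall x y : A, (x ⊓ x) ⊓ y = x ⊓ y;
  dba1b : forall x y : A, (x ⊔ x) ⊔ y = x ⊔ y;
  dba2a : forall x y : A, x ⊓ y = y ⊓ x;
  dba2b : forall x y : A, x ⊔ y = y ⊔ x;
  dba3a : forall x y z : A, x ⊓ (y ⊓ z) = (x ⊓ y) ⊓ z;
  dba3b : forall x y z : A, x ⊔ (y ⊔ z) = (x ⊔ y) ⊔ z;
  dba4a : forall x : A, ¬ (x ⊓ x) = ¬ x;
  dba4b : forall x : A, ⌟ (x ⊔ x) = ⌟ x;
  dba5a : forall x y : A, x ⊓ (x ⊔ y) = x ⊓ x;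
  dba5b : forall x y : A, x ⊔ (x ⊓ y) = x ⊔ x;
  dba6a : forall x y z : A, x ⊓ (y ⋎ z) = (x ⊓ y) ⋎ (x ⊓ z);
  dba6b : forall x y z : A, x ⊔ (y ⋏ z) = (x ⊔ y) ⋏ (x ⊔ z);
  dba7a : forall x y : A, x ⊓ (x ⋎ y) = x ⊓ x;
  dba7b : forall x y : A, x ⊔ (x ⋏ y) = x ⊔ x;
  dba8a : forall x y : A, ¬ ¬ (x ⊓ y) = x ⊓ y;
  dba8b : forall x y : A, ⌟ ⌟ (x ⊔ y) = x ⊔ y;
  dba9a : forall x : A, x ⊓ ¬ x = ⊥;
  dba9b : forall x : A, x ⊔ ⌟ x = ⊤;
  dba10a : ¬ ⊥ = ⊤ ⊓ ⊤ :> A;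
  dba10b : ⌟ ⊤ = ⊥ ⊔ ⊥ :> A;
  dba11a : ¬ ⊤ = ⊥ :> A;
  dba11b : ⌟ ⊥ = ⊤ :> A;
  dba12 : forall x : A, (x ⊓ x) ⊔ (x ⊓ x) = (x ⊔ x) ⊓ (x ⊔ x)
}.

Record dBa := {
  dba_sig :> dBaSig;
  dba_axioms : is_dBa dba_sig
}.

Definition contextual (A : dBa) : Prop := order A (@dle A).

(** * Double Boolean algebras with operators *)

Record dBao := {
  dbao_dba :> dBa;
  opI : dbao_dba -> dbao_dba;
  opC : dbao_dba -> dbao_dba;
  opI_mono : forall x y, x ⊑ y -> opI x ⊑ opI y;
  opC_mono : forall x y, x ⊑ y -> opC x ⊑ opC y;
  opI_meet : forall x y, opI (x ⊓ y) = opI x ⊓ opI y;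
  opC_join : forall x y, opC (x ⊔ y) = opC x ⊔ opC y;
  opI_neg_bot : opI (¬ ⊥) = ¬ ⊥;
  opC_opp_top : opC (⌟ ⊤) = ⌟ ⊤;
  opI_sq : forall x, opI (x ⊓ x) = opI x;
  opC_sq : forall x, opC (x ⊔ x) = opC x
}.

Arguments opI {_} x.
Arguments opC {_} x.

Record topological (O : dBao) : Prop := {
  opI_le : forall x : O, opI x ⊑ x;
  le_opC : forall x : O, x ⊑ opC x;
  opI_idem : forall x : O, opI (opI x) = opI x;
  opC_idem : forall x : O, opC (opC x) = opC x
}.

Definition contextual_dBao (O : dBao) : Prop := contextual O.

Definition topological_contextual_dBa (O : dBao) : Prop :=
  contextual O /\ topological O.

Local Close Scope dba_scope.

(** * Formulae and sequents *)

Inductive formula : Set :=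
| Var (p : nat)
| FTop
| FBot
| FJoin (a b : formula)
| FMeet (a b : formula)
| FNeg (a : formula)
| FOpp (a : formula)
| FBox (a : formula)
| FBbox (a : formula).

Declare Scope formula_scope.
Delimit Scope formula_scope with F.
Bind Scope formula_scope with formula.

Notation "x ⊔ y" := (FJoin x y) : formula_scope.
Notation "x ⊓ y" := (FMeet x y) : formula_scope.
Notation "¬ x" := (FNeg x) : formula_scope.
Notation "⌟ x" := (FOpp x) : formula_scope.
Notation "□ x" := (FBox x) : formula_scope.
Notation "■ x" := (FBbox x) : formula_scope.
Notation "⊤" := FTop : formula_scope.
Notation "⊥" := FBot : formula_scope.

Definition FVee (a b : formula) : formula := (¬ (¬ a ⊓ ¬ b))%F.
Definition FWedge (a b : formula) : formula := (⌟ (⌟ a ⊔ ⌟ b))%F.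

Notation "x ⋎ y" := (FVee x y) : formula_scope.
Notation "x ⋏ y" := (FWedge x y) : formula_scope.

Definition sequent : Set := (formula * formula)%type.

Notation "a ⊢ b" := ((a, b) : sequent) : formula_scope.

(** * The calculi *)

Local Open Scope formula_scope.

(** Suffixes [l] and [r] are the two directions of a schema stated with a
    two-sided turnstile. *)
Inductive MCDBL_axiom : sequent -> Prop :=
| ax1 a : MCDBL_axiom (a ⊢ a)
| ax2a a b : MCDBL_axiom (a ⊓ b ⊢ a)
| ax2b a b : MCDBL_axiom (a ⊢ a ⊔ b)
| ax3a a b : MCDBL_axiom (a ⊓ b ⊢ b)
| ax3b a b : MCDBL_axiom (b ⊢ a ⊔ b)
| ax4a a b : MCDBL_axiom (a ⊓ b ⊢ (a ⊓ b) ⊓ (a ⊓ b))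
| ax4b a b : MCDBL_axiom ((a ⊔ b) ⊔ (a ⊔ b) ⊢ a ⊔ b)
| ax5a a : MCDBL_axiom (¬ (a ⊓ a) ⊢ ¬ a)
| ax5b a : MCDBL_axiom (⌟ a ⊢ ⌟ (a ⊔ a))
| ax6a a : MCDBL_axiom (a ⊓ ¬ a ⊢ ⊥)
| ax6b a : MCDBL_axiom (⊤ ⊢ a ⊔ ⌟ a)
| ax7al a b : MCDBL_axiom (¬ ¬ (a ⊓ b) ⊢ a ⊓ b)
| ax7ar a b : MCDBL_axiom (a ⊓ b ⊢ ¬ ¬ (a ⊓ b))
| ax7bl a b : MCDBL_axiom (⌟ ⌟ (a ⊔ b) ⊢ a ⊔ b)
| ax7br a b : MCDBL_axiom (a ⊔ b ⊢ ⌟ ⌟ (a ⊔ b))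
| ax8a a b : MCDBL_axiom (a ⊓ a ⊢ a ⊓ (a ⊔ b))
| ax8b a b : MCDBL_axiom (a ⊔ (a ⊓ b) ⊢ a ⊔ a)
| ax9a a b : MCDBL_axiom (a ⊓ a ⊢ a ⊓ (a ⋎ b))
| ax9b a b : MCDBL_axiom (a ⊔ (a ⋏ b) ⊢ a ⊔ a)
| ax10al a b c : MCDBL_axiom (a ⊓ (b ⋎ c) ⊢ (a ⊓ b) ⋎ (a ⊓ c))
| ax10ar a b c : MCDBL_axiom ((a ⊓ b) ⋎ (a ⊓ c) ⊢ a ⊓ (b ⋎ c))
| ax10bl a b c : MCDBL_axiom (a ⊔ (b ⋏ c) ⊢ (a ⊔ b) ⋏ (a ⊔ c))
| ax10br a b c : MCDBL_axiom ((a ⊔ b) ⋏ (a ⊔ c) ⊢ a ⊔ (b ⋏ c))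
| ax11a a : MCDBL_axiom (⊥ ⊢ a)
| ax11b a : MCDBL_axiom (a ⊢ ⊤)
| ax12a : MCDBL_axiom (¬ ⊤ ⊢ ⊥)
| ax12b : MCDBL_axiom (⊤ ⊢ ⌟ ⊥)
| ax13al : MCDBL_axiom (¬ ⊥ ⊢ ⊤ ⊓ ⊤)
| ax13ar : MCDBL_axiom (⊤ ⊓ ⊤ ⊢ ¬ ⊥)
| ax13bl : MCDBL_axiom (⌟ ⊤ ⊢ ⊥ ⊔ ⊥)
| ax13br : MCDBL_axiom (⊥ ⊔ ⊥ ⊢ ⌟ ⊤)
| ax14l a : MCDBL_axiom ((a ⊔ a) ⊓ (a ⊔ a) ⊢ (a ⊓ a) ⊔ (a ⊓ a))
| ax14r a : MCDBL_axiom ((a ⊓ a) ⊔ (a ⊓ a) ⊢ (a ⊔ a) ⊓ (a ⊔ a))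
| ax15al a b : MCDBL_axiom (□ a ⊓ □ b ⊢ □ (a ⊓ b))
| ax15ar a b : MCDBL_axiom (□ (a ⊓ b) ⊢ □ a ⊓ □ b)
| ax15bl a b : MCDBL_axiom (■ a ⊔ ■ b ⊢ ■ (a ⊔ b))
| ax15br a b : MCDBL_axiom (■ (a ⊔ b) ⊢ ■ a ⊔ ■ b)
| ax16al : MCDBL_axiom (□ (¬ ⊥) ⊢ ¬ ⊥)
| ax16ar : MCDBL_axiom (¬ ⊥ ⊢ □ (¬ ⊥))
| ax16bl : MCDBL_axiom (■ (⌟ ⊤) ⊢ ⌟ ⊤)
| ax16br : MCDBL_axiom (⌟ ⊤ ⊢ ■ (⌟ ⊤))
| ax17al a : MCDBL_axiom (□ (a ⊓ a) ⊢ □ a)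
| ax17ar a : MCDBL_axiom (□ a ⊢ □ (a ⊓ a))
| ax17bl a : MCDBL_axiom (■ (a ⊔ a) ⊢ ■ a)
| ax17br a : MCDBL_axiom (■ a ⊢ ■ (a ⊔ a)).

Inductive MCDBL4_axiom : sequent -> Prop :=
| ax_MCDBL s : MCDBL_axiom s -> MCDBL4_axiom s
| ax18a a : MCDBL4_axiom (□ a ⊢ a)
| ax18b a : MCDBL4_axiom (a ⊢ ■ a)
| ax19al a : MCDBL4_axiom (□ □ a ⊢ □ a)
| ax19ar a : MCDBL4_axiom (□ a ⊢ □ □ a)
| ax19bl a : MCDBL4_axiom (■ ■ a ⊢ ■ a)
| ax19br a : MCDBL4_axiom (■ a ⊢ ■ ■ a).

(** [rule ps s]: the sequent [s] is inferred from the premises [ps]. *)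
Inductive rule : list sequent -> sequent -> Prop :=
| R1 a b c : rule [a ⊢ b] (a ⊓ c ⊢ b ⊓ c)
| R1' a b c : rule [a ⊢ b] (c ⊓ a ⊢ c ⊓ b)
| R2 a b c : rule [a ⊢ b] (a ⊔ c ⊢ b ⊔ c)
| R2' a b c : rule [a ⊢ b] (c ⊔ a ⊢ c ⊔ b)
| R3 a b : rule [a ⊢ b] (¬ b ⊢ ¬ a)
| R3' a b : rule [a ⊢ b] (⌟ b ⊢ ⌟ a)
| R4 a b c : rule [a ⊢ b; b ⊢ c] (a ⊢ c)
| R5 a b :
    rule [a ⊓ b ⊢ a ⊓ a; a ⊓ a ⊢ a ⊓ b; a ⊔ b ⊢ b ⊔ b; b ⊔ b ⊢ a ⊔ b] (a ⊢ b)
| R8 a b : rule [a ⊢ b] (□ a ⊢ □ b)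
| R9 a b : rule [a ⊢ b] (■ a ⊢ ■ b).

Local Close Scope formula_scope.

Definition derivation (Ax : sequent -> Prop) (l : list sequent) : Prop :=
  forall l1 s l2, l = l1 ++ s :: l2 ->
    Ax s \/ exists ps, rule ps s /\ incl ps l1.

Definition provable (Ax : sequent -> Prop) (s : sequent) : Prop :=
  exists l, derivation Ax (l ++ [s]).

(** * Validity *)

Record valuation (O : dBao) (v : formula -> O) : Prop := {
  val_join : forall a b, v (a ⊔ b)%F = (v a ⊔ v b)%D;
  val_meet : forall a b, v (a ⊓ b)%F = (v a ⊓ v b)%D;
  val_neg : forall a, v (¬ a)%F = (¬ v a)%D;
  val_opp : forall a, v (⌟ a)%F = (⌟ v a)%D;
  val_top : v ⊤%F = ⊤%D;
  val_bot : v ⊥%F = ⊥%D;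
  val_box : forall a, v (□ a)%F = opI (v a);
  val_bbox : forall a, v (■ a)%F = opC (v a)
}.

Definition satisfies (O : dBao) (v : formula -> O) (s : sequent) : Prop :=
  (v (fst s) ⊑ v (snd s))%D.

Definition true_in (O : dBao) (s : sequent) : Prop :=
  forall v : formula -> O, valuation v -> satisfies v s.

Definition valid_in (K : dBao -> Prop) (s : sequent) : Prop :=
  forall O : dBao, K O -> true_in O s.

(* Main.v *)
Require Import Defs.
From Stdlib Require Import List ClassicalEpsilon FunctionalExtensionality.
From Stdlib Require Import PropExtensionality.
From Corelib Require Import ssreflect.
Import ListNotations.

(** Soundness is an induction on derivations: a valuation into a contextual
    dBao satisfies every axiom and the rules preserve satisfaction.  All
    two-sided axioms become identities of the algebra.  The rules need that
    [⊓], [⊔] are monotone and [¬], [⌟] antitone for [⊑]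
    ([meet_mono], [join_mono], [neg_anti], [opp_anti]), and (R5) is where
    contextuality enters: its premises give, by antisymmetry, exactly the two
    equations that define [⊑].  Antitonicity of the negations rests on
    the absorption law [vee_absorb].

    Completeness is the Lindenbaum-Tarski construction.  Formulae modulo
    interderivability form a dBao ([lindenbaum]) in which the order of the
    classes is derivability of the representatives ([dle_cls]): one direction
    holds because [α ⊢ β] yields the four premises of (R5), the other is (R5)
    itself.  In particular this order is antisymmetric, so the dBao is
    contextual, and the quotient map is a valuation which satisfies only the
    provable sequents.  The construction works for every set of axioms that
    contains those of MCDBL; adding (18) and (19) makes it topological.

    The principle of duality (exchanging [⊓, ¬, ⊤] with [⊔, ⌟, ⊥] reverses
    [⊑]) halves the algebraic work. *)

(** * Order and operations in a double Boolean algebra *)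

Section Algebra.
Local Open Scope dba_scope.

Definition dual (A : dBaSig) : dBaSig :=
  {| carrier := A; djoin := @dmeet A; dmeet := @djoin A; dneg := @dopp A;
     dopp := @dneg A; dtop := @dbot A; dbot := @dtop A |}.

Lemma dual_is_dBa (A : dBaSig) : is_dBa A -> is_dBa (dual A).
Proof. by case=> *; split=> //= *; symmetry. Qed.

Lemma dle_dual (A : dBaSig) (HA : is_dBa A) (x y : A) :
  @dle (dual A) x y -> y ⊑ x.
Proof. by case=> /= e1 e2; split; rewrite (dba2a HA, dba2b HA). Qed.

Lemma dual_dle (A : dBaSig) (HA : is_dBa A) (x y : A) :
  y ⊑ x -> @dle (dual A) x y.
Proof. by case=> e1 e2; split=> /=; rewrite (dba2a HA, dba2b HA). Qed.

Lemma dle_refl (A : dBaSig) (x : A) : x ⊑ x.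
Proof. by []. Qed.

Lemma dle_eq (A : dBaSig) (x y : A) : x = y -> x ⊑ y.
Proof. by move=> ->. Qed.

Section MeetSide.
Variables (A : dBaSig) (HA : is_dBa A).

Lemma meet_sqr (x y : A) : x ⊓ (y ⊓ y) = x ⊓ y.
Proof. by rewrite (dba2a HA) (dba1a HA) (dba2a HA). Qed.

Lemma meet_meetl (x y : A) : x ⊓ (x ⊓ y) = x ⊓ y.
Proof. by rewrite (dba3a HA) (dba1a HA). Qed.

Lemma meet_idem (x y : A) : (x ⊓ y) ⊓ (x ⊓ y) = x ⊓ y.
Proof. by rewrite -(dba3a HA) (dba2a HA y) -(dba3a HA) meet_sqr meet_meetl. Qed.

(** For an idempotent [x] the meet half of [⊑] suffices: the join half follows
    from absorption (5b). *)
Lemma dle_of_meet (x y : A) : x ⊓ y = x -> x ⊑ y.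
Proof.
move=> e; split.
  by rewrite -{2 3}e meet_idem.
by rewrite -e (dba2b HA) (dba2a HA) (dba5b HA).
Qed.

Lemma meet_lel (x y : A) : x ⊓ y ⊑ x.
Proof. by apply: dle_of_meet; rewrite (dba2a HA) meet_meetl. Qed.

Lemma meet_ler (x y : A) : x ⊓ y ⊑ y.
Proof. by rewrite (dba2a HA); apply: meet_lel. Qed.

Lemma meet_mono (x y z : A) : x ⊑ y -> x ⊓ z ⊑ y ⊓ z.
Proof.
case=> e _; apply: dle_of_meet.
rewrite -(dba1a HA x z) -e -(dba3a HA x y z) (dba2a HA x) -(dba3a HA).
by rewrite (dba2a HA x) (dba3a HA) meet_idem.
Qed.

Lemma bot_le (x : A) : ⊥ ⊑ x.
Proof. by apply: dle_of_meet; rewrite -(dba9a HA x) (dba2a HA) meet_meetl. Qed.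

(** One absorption law of a lattice gives the other through distributivity;
    by (4a), [⋎] sees only the square of an argument. *)
Lemma vee_absorb (x y : A) : x ⋎ (x ⊓ y) = x ⊓ x.
Proof.
have -> : x ⋎ (x ⊓ y) = (x ⊓ x) ⋎ (x ⊓ y) by rewrite /dvee (dba4a HA).
by rewrite -(dba6a HA) (dba7a HA).
Qed.

(** If [x] is below [y] then [y ⋎ x] is the square of [y] by absorption;
    negating this identity gives [¬ y ⊓ ¬ x = ¬ y]. *)
Lemma neg_anti (x y : A) : x ⊑ y -> ¬ y ⊑ ¬ x.
Proof.
case=> e _; apply: dle_of_meet.
have ev : y ⋎ x = y ⊓ y.
  by rewrite -(vee_absorb y x) (dba2a HA) e /dvee (dba4a HA).
by rewrite -(dba8a HA) -/(y ⋎ x) ev (dba4a HA).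
Qed.

End MeetSide.

Section JoinSide.
Variables (A : dBaSig) (HA : is_dBa A).

Lemma join_idem (x y : A) : (x ⊔ y) ⊔ (x ⊔ y) = x ⊔ y.
Proof. exact: (meet_idem _ (dual_is_dBa _ HA)). Qed.

Lemma join_gel (x y : A) : x ⊑ x ⊔ y.
Proof. by apply/dle_dual/(meet_lel _ (dual_is_dBa _ HA)). Qed.

Lemma join_ger (x y : A) : y ⊑ x ⊔ y.
Proof. by apply/dle_dual/(meet_ler _ (dual_is_dBa _ HA)). Qed.

Lemma join_mono (x y z : A) : x ⊑ y -> x ⊔ z ⊑ y ⊔ z.
Proof.
by move=> h; apply/dle_dual/(meet_mono _ (dual_is_dBa _ HA))/dual_dle.
Qed.

Lemma le_top (x : A) : x ⊑ ⊤.
Proof. by apply/dle_dual/(bot_le _ (dual_is_dBa _ HA)). Qed.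

Lemma opp_anti (x y : A) : x ⊑ y -> ⌟ y ⊑ ⌟ x.
Proof.
by move=> h; apply/dle_dual/(neg_anti _ (dual_is_dBa _ HA))/dual_dle.
Qed.

End JoinSide.
End Algebra.

(** * Induction and closure under rules for derivations *)

Section Derivations.
Variable Ax : sequent -> Prop.

Lemma derivation_app l l' :
  derivation Ax l -> derivation Ax l' -> derivation Ax (l ++ l').
Proof.
move=> dl dl' l1 s l2 /app_eq_app [k [[el er]|[el er]]]; last first.
  case: (dl' _ _ _ er) => [?|[ps [r i]]]; [by left | right; exists ps].
  by split=> //; rewrite el; apply: incl_appr.
(* The sequent [s] opens [l'] if the overlap [k] is empty. *)
case: k el er => [|s' k] el er.
  case: (dl' [] s l2) => // [?|[ps [r i]]]; [by left | right; exists ps].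
  split=> //; apply: (incl_tran i); exact: incl_nil_l.
by case: er => ? _; subst s'; apply: dl el.
Qed.

Lemma derivation_snoc l s :
  derivation Ax l ->
  (Ax s \/ exists ps, rule ps s /\ incl ps l) -> derivation Ax (l ++ [s]).
Proof.
move=> dl js l1 t l2 /app_eq_app [k [[el er]|[el er]]].
  case: k el er => [|t' k] el er; last by case: er => ? _; subst t'; apply: dl el.
  by case: er => -> _; move: el js; rewrite app_nil_r => ->.
case: k el er => [|t' k] el er; last by case: k {el} er.
by case: er => <- _; rewrite el app_nil_r.
Qed.

Lemma provable_ax s : Ax s -> provable Ax s.
Proof.
move=> As; exists []; apply: derivation_snoc; last by left.
by move=> [|? ?].
Qed.

(** Derivations of the premises are concatenated and followed by [s]. *)
Lemma provable_rule ps s :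
  rule ps s -> Forall (provable Ax) ps -> provable Ax s.
Proof.
move=> r hps.
have [l [dl il]] : exists l, derivation Ax l /\ incl ps l.
  elim: {r} hps => [|p qs [l dl] _ [l' [dl' il']]].
    by exists []; split; [move=> [|? ?] | ].
  exists ((l ++ [p]) ++ l'); split; first exact: derivation_app.
  apply: incl_cons; last exact: incl_appr.
  by rewrite !in_app_iff; left; right; left.
by exists l; apply: derivation_snoc => //; right; exists ps.
Qed.

Lemma provable_ind (P : sequent -> Prop) :
  (forall s, Ax s -> P s) ->
  (forall ps s, rule ps s -> Forall P ps -> P s) ->
  forall s, provable Ax s -> P s.
Proof.
move=> hax hrule s [l dl].
suff /Forall_app [_ Ps] : Forall P (l ++ [s]) by apply: Forall_inv Ps.
elim/rev_ind: (l ++ [s]) dl => [|t m IH] d; first by constructor.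
have Pm : Forall P m.
  apply: IH => l1 u l2 e; apply: (d l1 u (l2 ++ [t])).
  by rewrite e -app_assoc.
rewrite Forall_app; split=> //; constructor=> //.
case: (d m t [] eq_refl) => [/hax //|[ps [r i]]].
exact: hrule r (incl_Forall i Pm).
Qed.

End Derivations.

(** * Soundness *)

Section Soundness.
Variables (O : dBao) (v : formula -> O).
Hypotheses (hO : contextual O) (hv : valuation v).
Let HA : is_dBa O := dba_axioms O.

Lemma val_vee a b : v (FVee a b) = dvee (v a) (v b).
Proof. by rewrite /FVee (val_neg hv) (val_meet hv) !(val_neg hv). Qed.

Lemma val_wedge a b : v (FWedge a b) = dwedge (v a) (v b).
Proof. by rewrite /FWedge (val_opp hv) (val_join hv) !(val_opp hv). Qed.

Definition valE :=
  (val_vee, val_wedge, val_join hv, val_meet hv, val_neg hv, val_opp hv,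
   val_top hv, val_bot hv, val_box hv, val_bbox hv).

Lemma axiom_sound s : MCDBL_axiom s -> satisfies v s.
Proof.
case=> *; rewrite /satisfies /= ?valE.
all: try by [exact: dle_refl | exact: meet_lel | exact: meet_ler
            | exact: join_gel | exact: join_ger | exact: bot_le | exact: le_top].
(* The other axioms hold with equality. *)
all: apply: dle_eq.
(* The operators go first: (10a) and (10b) would hide the argument of
   [opI_neg_bot] and [opC_opp_top]. *)
all: rewrite -?(opI_meet, opC_join) ?(opI_neg_bot, opC_opp_top, opI_sq, opC_sq).
all: by rewrite ?(meet_idem _ HA) ?(join_idem _ HA) ?(dba4a HA) ?(dba4b HA)
                ?(dba5a HA) ?(dba5b HA) ?(dba7a HA) ?(dba7b HA) ?(dba8a HA)
                ?(dba8b HA) ?(dba9a HA) ?(dba9b HA) ?(dba12 HA) ?(dba6a HA)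
                ?(dba6b HA) ?(dba10a HA) ?(dba10b HA) ?(dba11a HA) ?(dba11b HA).
Qed.

Lemma axiom4_sound (hT : topological O) s : MCDBL4_axiom s -> satisfies v s.
Proof.
case=> [{}s /axiom_sound // | ||||| ] a; rewrite /satisfies /= ?valE.
- exact: opI_le.
- exact: le_opC.
- by rewrite opI_idem.
- by rewrite opI_idem.
- by rewrite opC_idem.
- by rewrite opC_idem.
Qed.

Lemma rule_sound ps s : rule ps s -> Forall (satisfies v) ps -> satisfies v s.
Proof.
have [_ _ anti] := hO.
case=> [a b c|a b c|a b c|a b c|a b|a b|a b c|a b|a b|a b];
  rewrite ?Forall_cons_iff; rewrite /satisfies /= ?valE.
- by case=> h _; apply: meet_mono.
- by case=> h _; rewrite !(dba2a HA (v c)); apply: meet_mono.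
- by case=> h _; apply: join_mono.
- by case=> h _; rewrite !(dba2b HA (v c)); apply: join_mono.
- by case=> h _; apply: neg_anti.
- by case=> h _; apply: opp_anti.
- by have [_ tr _] := hO; case=> h [h' _]; apply: tr h h'.
- by case=> h1 [h2 [h3 [h4 _]]]; split; apply: anti.
- by case=> h _; apply: opI_mono.
- by case=> h _; apply: opC_mono.
Qed.

End Soundness.

(** * The Lindenbaum algebra *)

Section Lindenbaum.
Variable Ax : sequent -> Prop.
Hypothesis AxM : forall s, MCDBL_axiom s -> Ax s.
Local Open Scope formula_scope.

Definition entails (a b : formula) : Prop := provable Ax (a ⊢ b).
Definition equiv (a b : formula) : Prop := entails a b /\ entails b a.

Lemma entails_ax a b : MCDBL_axiom (a ⊢ b) -> entails a b.
Proof. by move=> h; apply/provable_ax/AxM. Qed.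

Lemma entails_rule1 a b c d :
  rule [a ⊢ b] (c ⊢ d) -> entails a b -> entails c d.
Proof. by move=> r h; apply: (provable_rule _ _ _ r); repeat constructor. Qed.

Lemma entails_trans a b c : entails a b -> entails b c -> entails a c.
Proof.
by move=> h h'; apply: (provable_rule _ _ _ (R4 a b c)); repeat constructor.
Qed.

Lemma entails_refl a : entails a a.
Proof. exact/entails_ax/ax1. Qed.

Lemma equiv_refl a : equiv a a.
Proof. by split; apply: entails_refl. Qed.

Lemma equiv_sym a b : equiv a b -> equiv b a.
Proof. by case. Qed.

Lemma equiv_trans a b c : equiv a b -> equiv b c -> equiv a c.
Proof. by move=> [h1 h2] [h3 h4]; split; apply: entails_trans; eassumption. Qed.

(** A meet is only the infimum among the idempotent elements, hence the
    condition that [c] entails its square. *)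
Lemma entails_meet c a b :
  entails c (c ⊓ c) -> entails c a -> entails c b -> entails c (a ⊓ b).
Proof.
move=> hc ha hb; apply: entails_trans hc _.
apply: entails_trans (entails_rule1 _ _ _ _ (R1 _ _ _) ha) _.
exact: (entails_rule1 _ _ _ _ (R1' _ _ _) hb).
Qed.

Lemma entails_join c a b :
  entails (c ⊔ c) c -> entails a c -> entails b c -> entails (a ⊔ b) c.
Proof.
move=> hc ha hb; apply: entails_trans _ hc.
apply: entails_trans (entails_rule1 _ _ _ _ (R2 _ _ _) ha) _.
exact: (entails_rule1 _ _ _ _ (R2' _ _ _) hb).
Qed.

Lemma meet_entails a b c d :
  entails (a ⊓ b) c -> entails (a ⊓ b) d -> entails (a ⊓ b) (c ⊓ d).
Proof. exact/entails_meet/entails_ax/ax4a. Qed.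

Lemma join_entails a b c d :
  entails c (a ⊔ b) -> entails d (a ⊔ b) -> entails (c ⊔ d) (a ⊔ b).
Proof. exact/entails_join/entails_ax/ax4b. Qed.

Lemma entails_meetl a b c : entails a c -> entails (a ⊓ b) c.
Proof. by apply: entails_trans; apply/entails_ax/ax2a. Qed.

Lemma entails_meetr a b c : entails b c -> entails (a ⊓ b) c.
Proof. by apply: entails_trans; apply/entails_ax/ax3a. Qed.

Lemma entails_joinl a b c : entails c a -> entails c (a ⊔ b).
Proof. by move/entails_trans; apply; apply/entails_ax/ax2b. Qed.

Lemma entails_joinr a b c : entails c b -> entails c (a ⊔ b).
Proof. by move/entails_trans; apply; apply/entails_ax/ax3b. Qed.

(** The four premises of (R5) are also necessary for its conclusion. *)
Lemma entails_iff a b :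
  entails a b <-> equiv (a ⊓ b) (a ⊓ a) /\ equiv (a ⊔ b) (b ⊔ b).
Proof.
split=> [h|[[h1 h2] [h3 h4]]]; last first.
  by apply: (provable_rule _ _ _ (R5 a b)); repeat constructor.
split; split.
- by apply: meet_entails; apply/entails_meetl/entails_refl.
- by apply: meet_entails; apply: entails_meetl => //; apply: entails_refl.
- by apply: join_entails; apply: entails_joinl => //; apply: entails_refl.
- by apply: join_entails; apply/entails_joinr/entails_refl.
Qed.

Lemma equiv_meet a a' b b' : equiv a a' -> equiv b b' -> equiv (a ⊓ b) (a' ⊓ b').
Proof.
by move=> [? ?] [? ?]; split; apply: meet_entails;
  [apply: entails_meetl | apply: entails_meetr
  |apply: entails_meetl | apply: entails_meetr].
Qed.

Lemma equiv_join a a' b b' : equiv a a' -> equiv b b' -> equiv (a ⊔ b) (a' ⊔ b').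
Proof.
by move=> [? ?] [? ?]; split; apply: join_entails;
  [apply: entails_joinl | apply: entails_joinr
  |apply: entails_joinl | apply: entails_joinr].
Qed.

Lemma equiv_neg a b : equiv a b -> equiv (¬ a) (¬ b).
Proof. by case=> ? ?; split; apply: entails_rule1 (R3 _ _) _. Qed.

Lemma equiv_opp a b : equiv a b -> equiv (⌟ a) (⌟ b).
Proof. by case=> ? ?; split; apply: entails_rule1 (R3' _ _) _. Qed.

Lemma equiv_box a b : equiv a b -> equiv (□ a) (□ b).
Proof. by case=> ? ?; split; apply: entails_rule1 (R8 _ _) _. Qed.

Lemma equiv_bbox a b : equiv a b -> equiv (■ a) (■ b).
Proof. by case=> ? ?; split; apply: entails_rule1 (R9 _ _) _. Qed.

(** By extensionality, equivalent formulae have the same class as predicates,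
    so the choice operator selects the same member for both. *)
Definition canon (a : formula) : formula := epsilon (inhabits ⊤) (equiv a).

Lemma canon_equiv a : equiv a (canon a).
Proof. by apply: epsilon_spec; exists a; apply: equiv_refl. Qed.

Lemma canon_eq a b : equiv a b -> canon a = canon b.
Proof.
move=> h; rewrite /canon; congr epsilon.
apply: functional_extensionality => c; apply: propositional_extensionality.
by split; apply: equiv_trans => //; apply: equiv_sym.
Qed.

(** The fixed points of [canon] form a transversal of [equiv]; a class is
    encoded by its member there, so that Leibniz equality of classes is
    equivalence and every class comes with a representative. *)
Definition quotient : Type := {a : formula | canon a = a}.

Definition cls (a : formula) : quotient :=
  exist _ (canon a) (eq_sym (canon_eq _ _ (canon_equiv a))).

Definition repr (x : quotient) : formula := proj1_sig x.

Lemma repr_cls a : equiv (repr (cls a)) a.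
Proof. exact/equiv_sym/canon_equiv. Qed.

Lemma repr_inj x y : repr x = repr y -> x = y.
Proof.
case: x y => a ea [b eb] /= e; case: _ / e eb => eb.
by rewrite (proof_irrelevance _ ea eb).
Qed.

Lemma cls_repr x : cls (repr x) = x.
Proof. by apply: repr_inj; case: x. Qed.

Lemma cls_eq a b : cls a = cls b <-> equiv a b.
Proof.
split=> [e|h]; last by apply: repr_inj; apply: canon_eq.
by apply: equiv_trans (canon_equiv a) _; rewrite -[canon a]/(repr (cls a)) e;
  apply: repr_cls.
Qed.

Definition lindenbaum_sig : dBaSig :=
  {| carrier := quotient;
     djoin := fun x y => cls (repr x ⊔ repr y);
     dmeet := fun x y => cls (repr x ⊓ repr y);
     dneg := fun x => cls (¬ repr x);
     dopp := fun x => cls (⌟ repr x);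
     dtop := cls ⊤;
     dbot := cls ⊥ |}.

Lemma cls_meet a b : cls (a ⊓ b) = @dmeet lindenbaum_sig (cls a) (cls b).
Proof. by apply/cls_eq/equiv_meet; apply: canon_equiv. Qed.

Lemma cls_join a b : cls (a ⊔ b) = @djoin lindenbaum_sig (cls a) (cls b).
Proof. by apply/cls_eq/equiv_join; apply: canon_equiv. Qed.

Lemma cls_neg a : cls (¬ a) = @dneg lindenbaum_sig (cls a).
Proof. by apply/cls_eq/equiv_neg/canon_equiv. Qed.

Lemma cls_opp a : cls (⌟ a) = @dopp lindenbaum_sig (cls a).
Proof. by apply/cls_eq/equiv_opp/canon_equiv. Qed.

Lemma dle_cls a b : @dle lindenbaum_sig (cls a) (cls b) <-> entails a b.
Proof. by rewrite entails_iff /dle -!cls_meet -!cls_join !cls_eq. Qed.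

Lemma quotient_ind (P : lindenbaum_sig -> Prop) :
  (forall a, P (cls a)) -> forall x, P x.
Proof. by move=> h x; rewrite -(cls_repr x). Qed.

(** A direction of an identity that is not an axiom holds, apart from
    (4), because meets and joins are bounds, which [meet_entails] and
    [join_entails] make optimal among idempotent formulae. *)
Lemma lindenbaum_is_dBa : is_dBa lindenbaum_sig.
Proof.
have topE : @dtop lindenbaum_sig = cls ⊤ by [].
have botE : @dbot lindenbaum_sig = cls ⊥ by [].
split; rewrite /dvee /dwedge ?(topE, botE); do ?elim/quotient_ind=> ?;
  rewrite -?(cls_meet, cls_join, cls_neg, cls_opp); apply/cls_eq; split.
all: try solve [apply: entails_ax; constructor].
all: try solve [repeat first [apply: meet_entails | apply: join_entails];
  solve [auto 8 using entails_refl, entails_meetl, entails_meetr,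
    entails_joinl, entails_joinr]].
(* What is left are the directions of (4a), (4b) that the axioms omit. *)
- by apply: entails_rule1 (R3 _ _) _; apply/entails_meetl/entails_refl.
- by apply: entails_rule1 (R3' _ _) _; apply/entails_joinl/entails_refl.
Qed.

Definition lindenbaum_dBa : dBa :=
  {| dba_sig := lindenbaum_sig; dba_axioms := lindenbaum_is_dBa |}.

Definition cls_box (x : lindenbaum_dBa) : lindenbaum_dBa := cls (□ repr x).
Definition cls_bbox (x : lindenbaum_dBa) : lindenbaum_dBa := cls (■ repr x).

Lemma cls_boxE a : cls (□ a) = cls_box (cls a).
Proof. by apply/cls_eq/equiv_box/canon_equiv. Qed.

Lemma cls_bboxE a : cls (■ a) = cls_bbox (cls a).
Proof. by apply/cls_eq/equiv_bbox/canon_equiv. Qed.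

Definition lindenbaum : dBao.
Proof.
refine (@Build_dBao lindenbaum_dBa cls_box cls_bbox _ _ _ _ _ _ _ _).
- elim/quotient_ind=> a; elim/quotient_ind=> b.
  by rewrite -!cls_boxE !dle_cls; apply: entails_rule1 (R8 _ _).
- elim/quotient_ind=> a; elim/quotient_ind=> b.
  by rewrite -!cls_bboxE !dle_cls; apply: entails_rule1 (R9 _ _).
- elim/quotient_ind=> a; elim/quotient_ind=> b.
  rewrite -cls_meet -!cls_boxE -cls_meet; apply/cls_eq.
  by split; apply: entails_ax; constructor.
- elim/quotient_ind=> a; elim/quotient_ind=> b.
  rewrite -cls_join -!cls_bboxE -cls_join; apply/cls_eq.
  by split; apply: entails_ax; constructor.
- rewrite -[dbot]/(cls ⊥) -cls_neg -cls_boxE; apply/cls_eq.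
  by split; apply: entails_ax; constructor.
- rewrite -[dtop]/(cls ⊤) -cls_opp -cls_bboxE; apply/cls_eq.
  by split; apply: entails_ax; constructor.
- elim/quotient_ind=> a; rewrite -cls_meet -!cls_boxE; apply/cls_eq.
  by split; apply: entails_ax; constructor.
- elim/quotient_ind=> a; rewrite -cls_join -!cls_bboxE; apply/cls_eq.
  by split; apply: entails_ax; constructor.
Defined.

Lemma lindenbaum_contextual : contextual lindenbaum.
Proof.
split.
- by move=> x; apply: dle_refl.
- elim/quotient_ind=> a; elim/quotient_ind=> b; elim/quotient_ind=> c.
  by rewrite !dle_cls; apply: entails_trans.
- elim/quotient_ind=> a; elim/quotient_ind=> b.
  by rewrite !dle_cls => *; apply/cls_eq.
Qed.

Lemma lindenbaum_topological :
  (forall s, MCDBL4_axiom s -> Ax s) -> topological lindenbaum.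
Proof.
move=> Ax4; split; elim/quotient_ind=> a /=; rewrite -?cls_boxE -?cls_bboxE.
- by apply/dle_cls/provable_ax/Ax4; constructor.
- by apply/dle_cls/provable_ax/Ax4; constructor.
- by apply/cls_eq; split; apply/provable_ax/Ax4; constructor.
- by apply/cls_eq; split; apply/provable_ax/Ax4; constructor.
Qed.

Lemma cls_valuation : @valuation lindenbaum cls.
Proof.
split=> //; [exact: cls_join | exact: cls_meet | exact: cls_neg | exact: cls_opp
            | exact: cls_boxE | exact: cls_bboxE].
Qed.

Lemma lindenbaum_complete a b : true_in lindenbaum (a ⊢ b) -> provable Ax (a ⊢ b).
Proof. by move=> /(_ _ cls_valuation) /dle_cls. Qed.

End Lindenbaum.

(** * Soundness and completeness *)

Theorem theorem33 (alpha beta : formula) :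
  (provable MCDBL_axiom (alpha ⊢ beta)%F <->
     valid_in contextual_dBao (alpha ⊢ beta)%F) /\
  (provable MCDBL4_axiom (alpha ⊢ beta)%F <->
     valid_in topological_contextual_dBa (alpha ⊢ beta)%F).
Proof.
split; split.
- move=> h O hO v hv; apply: provable_ind h.
  + exact: axiom_sound.
  + exact: rule_sound.
- move=> h; apply: (lindenbaum_complete _ (fun _ => id)); apply: h.
  exact: lindenbaum_contextual.
- move=> h O [hO hT] v hv; apply: provable_ind h.
  + exact: axiom4_sound.
  + exact: rule_sound.
- move=> h; apply: (lindenbaum_complete _ ax_MCDBL); apply: h; split.
  + exact: lindenbaum_contextual.
  + exact: lindenbaum_topological.
Qed.
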